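(* Let $A\in\mathbb{R}^{m,d}$, let $1\le s\le d$ be an integer and let $\theta\in[0,\pi]$. Suppose that the restricted isometry constants $\delta_s$ and $\delta_{2s}$ of $A$ satisfy $\delta_s<1$ and $$\frac{1}{1-\delta_s}\left(\delta_s+\sqrt{5}\,\sqrt{\frac{d}{s}+1}\;\frac{\delta_{2s}}{1+\delta_s}\right)\le\cos(\theta).$$ Then $\mathcal{D}^{\wedge\theta}(\|\cdot\|_1,x_0)\cap\ker A=\{0\}$ for every $s$-sparse $x_0\in\mathbb{R}^d$.
   Context: A vector is $k$-sparse if it has at most $k$ non-zero entries. The restricted isometry constant $\delta_k$ of $A$ is the smallest $\delta\ge0$ such that $(1-\delta)\|x\|_2^2\le\|Ax\|_2^2\le(1+\delta)\|x\|_2^2$ for all $k$-sparse $x\in\mathbb{R}^d$. The descent cone of $f:\mathbb{R}^d\to\mathbb{R}$ at $x_0$ is $\mathcal{D}(f,x_0)=\{\eta\in\mathbb{R}^d : \exists\tau>0,\ f(x_0+\tau\eta)\le f(x_0)\}$. For a convex cone $C\subseteq\mathbb{R}^d$ and $\theta\in[0,\pi]$, the $\theta$-expansion of $C$ is $C^{\wedge\theta}=\{0\}\cup\{x\in\mathbb{R}^d : \exists y\in C\setminus\{0\},\ \langle x,y\rangle\ge\cos(\theta)\|x\|_2\|y\|_2\}$, and $\mathcal{D}^{\wedge\theta}(f,x_0)=(\mathcal{D}(f,x_0))^{\wedge\theta}$. *)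

(* Defs.v *)
From HB Require Import structures.
From mathcomp Require Import all_boot all_order all_algebra.
From mathcomp Require Import all_classical all_reals all_analysis.
From mathcomp Require Import ring lra.

Set Implicit Arguments.
Unset Strict Implicit.
Unset Printing Implicit Defensive.

Import Order.TTheory GRing.Theory Num.Theory.

Local Open Scope classical_set_scope.
Local Open Scope ring_scope.

(* The library norm `|x| on matrices is the sup norm, hence the norms below. *)
Definition dotv (R : realType) (n : nat) (x y : 'cV[R]_n) : R :=
  \sum_(i < n) x i ord0 * y i ord0.

Definition l2norm (R : realType) (n : nat) (x : 'cV[R]_n) : R :=
  Num.sqrt (dotv x x).

Definition l1norm (R : realType) (n : nat) (x : 'cV[R]_n) : R :=
  \sum_(i < n) `|x i ord0|.

Definition sparse (R : realType) (n k : nat) (x : 'cV[R]_n) : Prop :=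
  (#|[pred i : 'I_n | (x i ord0 != 0)%R]| <= k)%N.

Definition rip_bounds (R : realType) (m n : nat) (A : 'M[R]_(m, n)) (k : nat)
    : set R :=
  [set delta | 0 <= delta /\
    forall x : 'cV[R]_n, sparse k x ->
      (1 - delta) * l2norm x ^+ 2 <= l2norm (A *m x) ^+ 2
      /\ l2norm (A *m x) ^+ 2 <= (1 + delta) * l2norm x ^+ 2].

(* The infimum is attained, see ric_smallest. *)
Definition ric (R : realType) (m n : nat) (A : 'M[R]_(m, n)) (k : nat) : R :=
  inf (rip_bounds A k).

Definition descent_cone (R : realType) (n : nat) (f : 'cV[R]_n -> R)
    (x0 : 'cV[R]_n) : set 'cV[R]_n :=
  [set eta | exists tau : R, 0 < tau /\ f (x0 + tau *: eta) <= f x0].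

(* Defined for every set C; of interest when C is a convex cone and
   0 <= theta <= pi. *)
Definition cone_expansion (R : realType) (n : nat) (theta : R)
    (C : set 'cV[R]_n) : set 'cV[R]_n :=
  [set 0] `|` [set x | exists y, [/\ C y, y != 0 &
    cos theta * l2norm x * l2norm y <= dotv x y]].

Definition expanded_descent_cone (R : realType) (n : nat) (theta : R)
    (f : 'cV[R]_n -> R) (x0 : 'cV[R]_n) : set 'cV[R]_n :=
  cone_expansion theta (descent_cone f x0).

Definition ker_mx (R : realType) (m n : nat) (A : 'M[R]_(m, n))
    : set 'cV[R]_n :=
  [set x | A *m x = 0].

Lemma l2norm_sqr (R : realType) (n : nat) (x : 'cV[R]_n) :
  l2norm x ^+ 2 = dotv x x.
Proof.
by rewrite /l2norm sqr_sqrtr // /dotv sumr_ge0 // => i _; rewrite -expr2 sqr_ge0.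
Qed.

Lemma rip_bounds_neq0 (R : realType) (m n : nat) (A : 'M[R]_(m, n)) (k : nat) :
  rip_bounds A k !=set0.
Proof.
pose c := \sum_(i < m) (\sum_(j < n) `|A i j|) ^+ 2.
have c0 : 0 <= c by apply: sumr_ge0 => i _; exact: sqr_ge0.
exists (1 + c); split; first by lra.
move=> x _; rewrite !l2norm_sqr.
have x0 : 0 <= dotv x x by apply: sumr_ge0 => i _; rewrite -expr2 sqr_ge0.
have y0 : 0 <= dotv (A *m x) (A *m x).
  by apply: sumr_ge0 => i _; rewrite -expr2 sqr_ge0.
have yx : dotv (A *m x) (A *m x) <= c * dotv x x.
  rewrite {1}/dotv /c mulr_suml; apply: ler_sum => i _.
  rewrite -l2norm_sqr -exprMn -expr2 -[leLHS]real_normK ?num_real//.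
  have l0 : 0 <= l2norm x by exact: sqrtr_ge0.
  rewrite ler_pXn2r ?nnegrE ?mulr_ge0 ?sumr_ge0 // mxE mulr_suml.
  apply: le_trans (ler_norm_sum _ _ _) _; apply: ler_sum => j _.
  rewrite normrM; apply: ler_wpM2l => //.
  rewrite -(ler_pXn2r (n := 2)) ?nnegrE // l2norm_sqr real_normK ?num_real//.
  rewrite /dotv (bigD1 j) //= -expr2 lerDl sumr_ge0 // => l _.
  by rewrite -expr2 sqr_ge0.
by split; nra.
Qed.

Lemma ric_smallest (R : realType) (m n : nat) (A : 'M[R]_(m, n)) (k : nat) :
  rip_bounds A k (ric A k) /\
  forall delta, rip_bounds A k delta -> ric A k <= delta.
Proof.
have lb0 : lbound (rip_bounds A k) 0 by move=> d [].
have hi : has_inf (rip_bounds A k).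
  by split; [exact: rip_bounds_neq0 | exists 0].
split; last by move=> d dP; apply: ge_inf => //; exists 0.
split; first exact: lb_le_inf hi.1 lb0.
move=> x kx; set a := l2norm x ^+ 2; set b := l2norm (A *m x) ^+ 2.
have a0 : 0 <= a by exact: sqr_ge0.
have close (e : R) : 0 < e -> (1 - ric A k) * a <= b + e * a /\
    b <= (1 + ric A k) * a + e * a.
  move=> e0; have [d [_ /(_ x kx) [dl du]] dr] := inf_adherent e0 hi.
  rewrite -/(ric A k) in dr; rewrite -/a -/b in dl du.
  by split; nra.
move: a0; rewrite le_eqVlt => /orP[/eqP a0|a0].
  by have [] := close 1 ltr01; rewrite -a0 !mulr0 !addr0.
split; apply/ler_addgt0Pr => e e0.
  have [+ _] := close (e / a) (divr_gt0 e0 a0).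
  by rewrite divfK // gt_eqF.
have [_ +] := close (e / a) (divr_gt0 e0 a0).
by rewrite divfK // gt_eqF.
Qed.

(* Main.v *)
Require Import Defs.
From HB Require Import structures.
From mathcomp Require Import all_boot all_order all_algebra.
From mathcomp Require Import all_classical all_reals all_analysis.
From mathcomp Require Import ring lra.

(** Let [x] be a nonzero kernel vector and [y] a nonzero descent direction of
    the l1 norm at the [s]-sparse vector [x0]; write [D] for the isometry
    constant of order [2 s].  It suffices to show
      [<x, y> < sqrt 5 * sqrt (d / s + 1) * D * |x| * |y|]:
    the constant on the right is at most [cos theta], because dividing by
    [(1 - e) * (1 + e) <= 1] and adding [e / (1 - e) >= 0], with [e] the
    constant of order [s], only increases it.

    Sort the coordinates by decreasing magnitude of [y] and cut them into
    consecutive blocks of size [s], the last one possibly shorter.  As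
    [A x = 0], the product [<x, y>] equals the sum over pairs of blocks of the
    defects [<x_k, y_l> - <A x_k, A y_l>].  Each pair lives on at most [2 s]
    coordinates, so polarization of the isometry bounds ([rip_dotv]) gives
      [|<x, y>| <= D * (sum_k |x_k|) * (sum_l |y_l|)]   ([ker_dotv_le]).

    Cauchy--Schwarz bounds the sum over [x] by [sqrt N * |x|], where the
    number [N] of blocks is less than [d / s + 1]; this is where strictness
    comes from.  For the sum over [y], the descent condition says that [y] has
    no more l1 mass off the support of [x0] than on it, hence no more off its
    leading block than on it.  By the decreasing order, the blocks beyond the
    first two then contribute at most [|y_0|] in total, and
    [2 |y_0| + |y_1| <= sqrt 5 * |y|]   ([sum_l2norm_blocks_le]).

    If [D = 0] the strict inequality fails, but then [A] is injective
    ([ric_eq0_ker]) and there is no such [x]. *)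

Set Implicit Arguments.
Unset Strict Implicit.
Unset Printing Implicit Defensive.

Import Order.TTheory GRing.Theory Num.Theory.

Local Open Scope classical_set_scope.
Local Open Scope ring_scope.

(** * The Euclidean inner product and norm *)

Lemma dotvC (R : realType) n (x y : 'cV[R]_n) : dotv x y = dotv y x.
Proof. by apply: eq_bigr => i _; rewrite mulrC. Qed.

Lemma dotvDl (R : realType) n (x y z : 'cV[R]_n) :
  dotv (x + y) z = dotv x z + dotv y z.
Proof. by rewrite -big_split; apply: eq_bigr => i _; rewrite mxE mulrDl. Qed.

Lemma dotvZl (R : realType) n a (x y : 'cV[R]_n) :
  dotv (a *: x) y = a * dotv x y.
Proof. by rewrite mulr_sumr; apply: eq_bigr => i _; rewrite mxE mulrA. Qed.

Lemma dotv0l (R : realType) n (y : 'cV[R]_n) : dotv 0 y = 0.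
Proof. by apply: big1 => i _; rewrite mxE mul0r. Qed.

Lemma dotvDr (R : realType) n (x y z : 'cV[R]_n) :
  dotv x (y + z) = dotv x y + dotv x z.
Proof. by rewrite !(dotvC x) dotvDl. Qed.

Lemma dotvZr (R : realType) n a (x y : 'cV[R]_n) :
  dotv x (a *: y) = a * dotv x y.
Proof. by rewrite !(dotvC x) dotvZl. Qed.

Lemma dotv_suml (R : realType) n N (x : 'I_N -> 'cV[R]_n) y :
  dotv (\sum_k x k) y = \sum_k dotv (x k) y.
Proof. by elim/big_rec2: _ => [|k a b _ <-]; rewrite ?dotv0l ?dotvDl. Qed.

Lemma dotv_sumr (R : realType) n N x (y : 'I_N -> 'cV[R]_n) :
  dotv x (\sum_k y k) = \sum_k dotv x (y k).
Proof. by rewrite dotvC dotv_suml; apply: eq_bigr => k _; rewrite dotvC. Qed.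

Lemma l2norm_ge0 (R : realType) n (x : 'cV[R]_n) : 0 <= l2norm x.
Proof. exact: sqrtr_ge0. Qed.

Lemma l2norm_eq0 (R : realType) n (x : 'cV[R]_n) : l2norm x = 0 -> x = 0.
Proof.
move=> x0; have /eqP : dotv x x = 0 by rewrite -l2norm_sqr x0 expr0n.
rewrite psumr_eq0 => [/allP x20|i _]; last by rewrite -expr2 sqr_ge0.
apply/colP => i; rewrite mxE; apply/eqP.
by have := x20 i (mem_index_enum i); rewrite -expr2 sqrf_eq0.
Qed.

Lemma l2norm_gt0 (R : realType) n (x : 'cV[R]_n) : x != 0 -> 0 < l2norm x.
Proof.
move=> x0; rewrite lt_def l2norm_ge0 andbT.
by apply: contra_neq x0; exact: l2norm_eq0.
Qed.

(** Cauchy--Schwarz against the constant sequence, by expanding the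
    nonnegative double sum of [(f i - f j) ^+ 2]. *)
Lemma sqr_sum_le_card (R : realType) (I : finType) (P : pred I) (f : I -> R) :
  (\sum_(i | P i) f i) ^+ 2 <= #|P|%:R * \sum_(i | P i) f i ^+ 2.
Proof.
have : 0 <= \sum_(i | P i) \sum_(j | P j) (f i - f j) ^+ 2.
  by apply: sumr_ge0 => i _; apply: sumr_ge0 => j _; exact: sqr_ge0.
set S1 := \sum_(i | P i) f i; set S2 := \sum_(i | P i) f i ^+ 2.
suff -> : \sum_(i | P i) \sum_(j | P j) (f i - f j) ^+ 2 =
    #|P|%:R * S2 *+ 2 - S1 ^+ 2 *+ 2 by lra.
transitivity (\sum_(i | P i) (#|P|%:R * f i ^+ 2 - f i * S1 *+ 2 + S2)).
  apply: eq_bigr => i _.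
  transitivity (\sum_(j | P j) (f i ^+ 2 + f i * (- 2 * f j) + f j ^+ 2)).
    by apply: eq_bigr => j _; ring.
  rewrite !big_split /= sumr_const -mulr_sumr -mulr_sumr -/S1 -/S2.
  rewrite -[in LHS](mulr_natl (f i ^+ 2)); ring.
rewrite !big_split /= sumrN sumrMnl -mulr_suml -mulr_sumr sumr_const -/S1 -/S2.
by rewrite -[S2 *+ _]mulr_natl; ring.
Qed.

(** * Restriction of vectors to blocks of coordinates *)

Definition restr (R : realType) n (P : pred 'I_n) (x : 'cV[R]_n) : 'cV[R]_n :=
  \col_i (if P i then x i ord0 else 0).

Lemma sparse_supported (R : realType) n k (P : pred 'I_n) (x : 'cV[R]_n) :
  (#|P| <= k)%N -> (forall i, ~~ P i -> x i ord0 = 0) -> sparse k x.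
Proof.
move=> Pk xP; apply: leq_trans Pk; apply: subset_leq_card.
by apply/fintype.subsetP => i; rewrite !inE; apply: contraR => /xP ->.
Qed.

Lemma l1norm_restr (R : realType) n (P : pred 'I_n) (x : 'cV[R]_n) :
  l1norm (restr P x) = \sum_(i | P i) `|x i ord0|.
Proof.
rewrite [RHS]big_mkcond; apply: eq_bigr => i _.
by rewrite mxE; case: ifP => //; rewrite normr0.
Qed.

Lemma l2norm_restr_sqr (R : realType) n (P : pred 'I_n) (x : 'cV[R]_n) :
  l2norm (restr P x) ^+ 2 = \sum_(i | P i) `|x i ord0| ^+ 2.
Proof.
rewrite l2norm_sqr [RHS]big_mkcond; apply: eq_bigr => i _.
by rewrite mxE; case: ifP; rewrite ?mul0r // real_normK ?num_real.
Qed.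

Lemma sum_fiber (V : nmodType) N (b : nat) (v : V) :
  (b < N)%N -> \sum_(k < N) (if b == k then v else 0) = v.
Proof.
move=> bN; rewrite (bigD1 (Ordinal bN)) //= eqxx big1 ?addr0 // => k kb.
by case: eqP => // bk; case/eqP: kb; exact: val_inj.
Qed.

Lemma sum_restr (R : realType) n N (b : 'I_n -> nat) (x : 'cV[R]_n) :
  (forall i, b i < N)%N ->
  x = \sum_(k < N) restr (fun i => b i == k) x.
Proof.
move=> bN; apply/colP => i; rewrite summxE.
rewrite -[LHS](@sum_fiber _ N (b i) _ (bN i)).
by apply: eq_bigr => k _; rewrite mxE.
Qed.

Lemma sum_l1norm_restr (R : realType) n N (b : 'I_n -> nat) (x : 'cV[R]_n) :
  (forall i, b i < N)%N ->
  \sum_(k < N) l1norm (restr (fun i => b i == k) x) = l1norm x.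
Proof.
move=> bN; under eq_bigr do rewrite l1norm_restr big_mkcond.
rewrite exchange_big; apply: eq_bigr => i _; exact: sum_fiber.
Qed.

Lemma sum_l2norm_restr_sqr (R : realType) n N (b : 'I_n -> nat)
    (x : 'cV[R]_n) :
  (forall i, b i < N)%N ->
  \sum_(k < N) l2norm (restr (fun i => b i == k) x) ^+ 2 = l2norm x ^+ 2.
Proof.
move=> bN; under eq_bigr do rewrite l2norm_restr_sqr big_mkcond.
rewrite exchange_big l2norm_sqr; apply: eq_bigr => i _.
by rewrite sum_fiber // real_normK ?num_real // expr2.
Qed.

Lemma sum_l2norm_restr_le (R : realType) n N (b : 'I_n -> nat)
    (x : 'cV[R]_n) :
  (forall i, b i < N)%N ->
  \sum_(k < N) l2norm (restr (fun i => b i == k) x) <=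
    Num.sqrt N%:R * l2norm x.
Proof.
move=> bN; rewrite -(ler_pXn2r (n := 2)) ?nnegrE.
- rewrite exprMn sqr_sqrtr ?ler0n // -(sum_l2norm_restr_sqr x bN).
  have := @sqr_sum_le_card _ 'I_N predT
    (fun k => l2norm (restr (fun i => b i == k) x)).
  by rewrite cardT size_enum_ord.
- by [].
- by apply: sumr_ge0 => k _; exact: l2norm_ge0.
- by rewrite mulr_ge0 ?sqrtr_ge0 ?l2norm_ge0.
Qed.

(** * Restricted near-orthogonality *)

(** The form [<Au, Av> - <u, v>] is bounded by the isometry constant on the
    diagonal.  Subtracting the isometry bounds at [|v| u + |u| v] and
    [|v| u - |u| v] isolates its value at [(u, v)]; scaling both terms to the
    common length [|u| |v|] makes the bound a product of norms. *)
Lemma rip_dotv (R : realType) m n (A : 'M[R]_(m, n)) k (P : pred 'I_n)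
    (u v : 'cV[R]_n) :
  (#|P| <= k)%N ->
  (forall i, ~~ P i -> u i ord0 = 0) -> (forall i, ~~ P i -> v i ord0 = 0) ->
  `|dotv (A *m u) (A *m v) - dotv u v| <= ric A k * (l2norm u * l2norm v).
Proof.
move=> Pk uP vP.
have [[_ rip] _] := ric_smallest A k; set dl := ric A k in rip *.
have [->|u0] := eqVneq u 0.
  rewrite mulmx0 !dotv0l subrr normr0.
  by rewrite /l2norm !dotv0l sqrtr0 mul0r mulr0.
have [->|v0] := eqVneq v 0.
  rewrite mulmx0 !(dotvC _ 0) !dotv0l subrr normr0.
  by rewrite /l2norm dotv0l sqrtr0 !mulr0.
have comb a b : sparse k (a *: u + b *: v).
  apply: sparse_supported Pk _ => i Pi.
  by rewrite !mxE uP // vP // !mulr0 addr0.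
have [a0 b0] : 0 < l2norm u /\ 0 < l2norm v by split; exact: l2norm_gt0.
have dotw t : dotv (l2norm v *: u + t *: v) (l2norm v *: u + t *: v) =
    l2norm v ^+ 2 * dotv u u + 2 * l2norm v * t * dotv u v
    + t ^+ 2 * dotv v v.
  by rewrite !(dotvDl, dotvDr, dotvZl, dotvZr) (dotvC v u); ring.
have dotAw t : dotv (A *m (l2norm v *: u + t *: v))
      (A *m (l2norm v *: u + t *: v)) =
    l2norm v ^+ 2 * dotv (A *m u) (A *m u)
    + 2 * l2norm v * t * dotv (A *m u) (A *m v)
    + t ^+ 2 * dotv (A *m v) (A *m v).
  rewrite mulmxDr -!scalemxAr !(dotvDl, dotvDr, dotvZl, dotvZr).
  by rewrite (dotvC (A *m v) (A *m u)); ring.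
have := rip _ (comb (l2norm v) (- l2norm u)).
have := rip _ (comb (l2norm v) (l2norm u)).
have ab0 : 0 < l2norm u * l2norm v by exact: mulr_gt0.
rewrite !l2norm_sqr !dotw !dotAw -(l2norm_sqr u) -(l2norm_sqr v).
move=> [l1 h1] [l2 h2].
by rewrite ler_norml; apply/andP; split; rewrite -(ler_pM2l ab0); lra.
Qed.

(** For [A x = 0] all of [<x, y>] is the defect [<x, y> - <Ax, Ay>].
    Expanding both vectors into blocks of size at most [s] leaves pairs of
    blocks, each of which lives on at most [2 s] coordinates. *)
Lemma ker_dotv_le (R : realType) m n (A : 'M[R]_(m, n)) s N (b : 'I_n -> nat)
    (x y : 'cV[R]_n) :
  (forall i, b i < N)%N ->
  (forall k, #|[pred i | b i == k]| <= s)%N ->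
  A *m x = 0 ->
  `|dotv x y| <= ric A (2 * s) *
    ((\sum_(k < N) l2norm (restr (fun i => b i == k) x)) *
     (\sum_(k < N) l2norm (restr (fun i => b i == k) y))).
Proof.
move=> bN bs Ax0.
set xb := fun k : 'I_N => restr (fun i => b i == k) x.
set yb := fun k : 'I_N => restr (fun i => b i == k) y.
have -> : dotv x y = - \sum_k \sum_l
    (dotv (A *m xb k) (A *m yb l) - dotv (xb k) (yb l)).
  transitivity (- (dotv (A *m x) (A *m y) - dotv x y)).
    by rewrite Ax0 dotv0l sub0r opprK.
  congr (- _); under eq_bigr do rewrite sumrB -!dotv_sumr.
  by rewrite sumrB -!dotv_suml -!mulmx_sumr -!sum_restr.
rewrite normrN mulr_suml mulr_sumr.
apply: le_trans (ler_norm_sum _ _ _) _; apply: ler_sum => k _.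
rewrite mulr_sumr mulr_sumr.
apply: le_trans (ler_norm_sum _ _ _) _; apply: ler_sum => l _.
apply: (@rip_dotv _ _ _ _ _ (fun i => (b i == k) || (b i == l))).
- rewrite mul2n -addnn.
  apply: leq_trans (leq_add (bs k) (bs l)).
  by rewrite -cardUI leq_addr.
- by move=> i; rewrite negb_or mxE => /andP[/negbTE -> _].
- by move=> i; rewrite negb_or mxE => /andP[_ /negbTE ->].
Qed.

(** * Vectors sorted by decreasing magnitude *)

Lemma exists_rank (R : realType) n (f : 'I_n -> R) :
  exists2 r : 'I_n -> 'I_n, injective r &
    forall i j, (r i <= r j)%N -> f j <= f i.
Proof.
pose leT (i j : 'I_n) := f j <= f i.
pose o := sort leT (enum 'I_n).
have oin i : i \in o by rewrite mem_sort mem_enum.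
have szo : size o = n by rewrite size_sort size_enum_ord.
have rlt i : (index i o < n)%N by rewrite -[X in (_ < X)%N]szo index_mem.
have leT_tr : transitive leT by move=> j i k ji kj; exact: le_trans kj ji.
have leT_tot : total leT by move=> i j; exact: le_total.
exists (fun i => Ordinal (rlt i)).
  move=> i j /(congr1 val) /= ij; rewrite -(nth_index i (oin i)) ij.
  exact: nth_index.
move=> i j /=; apply: (sorted_leq_index leT_tr) => //.
- by move=> k; exact: lexx.
- exact: sort_sorted.
Qed.

Lemma card_rank_block_le n s k (r : 'I_n -> 'I_n) :
  injective r -> (0 < s)%N -> (#|[pred i | (r i %/ s)%N == k]| <= s)%N.
Proof.
move=> rI s0.
rewrite -[X in (_ <= X)%N]card_ord.
rewrite -(@card_in_imset _ _ (fun i => Ordinal (ltn_pmod (r i) s0))).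
  exact: max_card.
move=> i j; rewrite !inE => /eqP ik /eqP jk [ij].
by apply/rI/val_inj; rewrite /= (divn_eq (r i) s) (divn_eq (r j) s) ik jk ij.
Qed.

Lemma card_rank_block_ge n s k (r : 'I_n -> 'I_n) :
  injective r -> (k.+1 * s <= n)%N ->
  (s <= #|[pred i | (r i %/ s)%N == k]|)%N.
Proof.
move=> rI ksn; have [s0|s0] := posnP s; first by rewrite s0.
have lt_n (t : 'I_s) : (k * s + t < n)%N.
  by apply: leq_trans ksn; rewrite mulSnr ltn_add2l.
rewrite -[X in (X <= _)%N]card_ord.
pose g t := invF rI (Ordinal (lt_n t)).
rewrite -(@card_imset _ _ g).
  apply: subset_leq_card; apply/fintype.subsetP => _ /imsetP[t _ ->].
  by rewrite inE f_invF /= divnMDl // divn_small // addn0.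
move=> t u /(congr1 r); rewrite /g !f_invF => /(congr1 val) /= /addnI.
exact: val_inj.
Qed.

(** Each entry on [P] is at most the average of the [s] or more entries on
    [Q]; squaring and summing over the at most [s] positions of [P] trades
    the l1 norm for the l2 norm with the gain [sqrt s]. *)
Lemma l2norm_le_l1norm_dominated (R : realType) n s (P Q : pred 'I_n)
    (y : 'cV[R]_n) :
  (0 < s)%N -> (#|P| <= s)%N -> (forall i, P i -> s <= #|Q|)%N ->
  (forall i j, P i -> Q j -> `|y i ord0| <= `|y j ord0|) ->
  Num.sqrt s%:R * l2norm (restr P y) <= l1norm (restr Q y).
Proof.
move=> s0 Ps sQ PQ; rewrite l1norm_restr; set L := \sum_(i | Q i) _.
have L0 : 0 <= L by exact: sumr_ge0.
have sR : (0 : R) < s%:R by rewrite ltr0n.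
have ent i : P i -> s%:R * `|y i ord0| <= L.
  move=> Pi; apply: (@le_trans _ _ (#|Q|%:R * `|y i ord0|)).
    by apply: ler_wpM2r => //; rewrite ler_nat; exact: sQ Pi.
  rewrite mulr_natl -sumr_const; apply: ler_sum => j Qj; exact: PQ.
rewrite -(ler_pXn2r (n := 2)) ?nnegrE ?mulr_ge0 ?sqrtr_ge0 ?l2norm_ge0 //.
rewrite exprMn sqr_sqrtr ?ler0n // -(ler_pM2l sR).
rewrite l2norm_restr_sqr mulrA -expr2 mulr_sumr.
apply: (@le_trans _ _ (#|P|%:R * L ^+ 2)).
  rewrite mulr_natl -sumr_const; apply: ler_sum => i Pi.
  by rewrite -exprMn ler_pXn2r ?nnegrE ?mulr_ge0 ?ent // ler0n.
by apply: ler_wpM2r; [exact: sqr_ge0|rewrite ler_nat].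
Qed.

Lemma l1norm_restr_le_l2norm (R : realType) n s (P : pred 'I_n)
    (y : 'cV[R]_n) :
  (#|P| <= s)%N ->
  l1norm (restr P y) <= Num.sqrt s%:R * l2norm (restr P y).
Proof.
move=> Ps; rewrite -(ler_pXn2r (n := 2)) ?nnegrE.
- rewrite exprMn sqr_sqrtr ?ler0n // l1norm_restr l2norm_restr_sqr.
  apply: le_trans (sqr_sum_le_card P (fun i => `|y i ord0|)) _.
  apply: ler_wpM2r; first by apply: sumr_ge0 => i _; exact: sqr_ge0.
  by rewrite ler_nat.
- by [].
- by rewrite l1norm_restr sumr_ge0.
- by rewrite mulr_ge0 ?sqrtr_ge0.
Qed.

(** After cancelling the common indices, the largest value on [S] outside [T]
    separates the two sides. *)
Lemma sum_le_top (R : realType) (I : finType) (S T : pred I) (f : I -> R) :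
  (#|S| <= #|T|)%N -> (forall i j, T i -> ~~ T j -> f j <= f i) ->
  (forall i, 0 <= f i) ->
  \sum_(i | S i) f i <= \sum_(i | T i) f i.
Proof.
move=> ST top f0.
rewrite (bigID T) [leRHS](bigID S) /=.
under [X in _ <= X + _]eq_bigl do rewrite andbC.
rewrite lerD2l.
have [j0 Dj0|D0] := pickP (fun i => S i && ~~ T i); last first.
  by rewrite big_pred0 // sumr_ge0.
case: (@arg_maxP _ R I j0 (fun i => S i && ~~ T i) f Dj0) => j /andP[Sj Tj] jmax.
apply: (@le_trans _ _ (\sum_(i | S i && ~~ T i) f j)).
  by apply: ler_sum => i; exact: jmax.
apply: (@le_trans _ _ (\sum_(i | T i && ~~ S i) f j)); last first.
  by apply: ler_sum => i /andP[Ti _]; exact: top.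
rewrite !sumr_const; apply: ler_wpMn2l => //.
rewrite -(leq_add2l #|[predI S & T]|).
have -> : #|(fun i => S i && ~~ T i)| = #|[predD S & T]|.
  by apply: eq_card => i; rewrite !inE /in_mem /= andbC.
have -> : #|(fun i => T i && ~~ S i)| = #|[predD T & S]|.
  by apply: eq_card => i; rewrite !inE /in_mem /= andbC.
rewrite cardID.
have -> : #|[predI S & T]| = #|[predI T & S]|.
  by apply: eq_card => i; rewrite !inE andbC.
by rewrite cardID.
Qed.

(** A step from [x0] lowers the l1 norm on the support of [x0] by at most the
    mass of the step there, and raises it elsewhere by the mass of the step. *)
Lemma descent_cone_l1norm (R : realType) n (x0 y : 'cV[R]_n) :
  descent_cone (@l1norm R n) x0 y ->
  \sum_(i | x0 i ord0 == 0) `|y i ord0| <=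
  \sum_(i | x0 i ord0 != 0) `|y i ord0|.
Proof.
move=> [t [t0 le]]; rewrite -(ler_pM2l t0) !mulr_sumr.
move: le; rewrite /l1norm (bigID (fun i => x0 i ord0 == 0)) /=.
rewrite [leRHS](bigID (fun i => x0 i ord0 == 0)) /=.
rewrite [X in _ <= X + _]big1 ?add0r; last first.
  by move=> i /eqP ->; rewrite normr0.
have -> : \sum_(i | x0 i ord0 == 0) `|(x0 + t *: y) i ord0| =
    \sum_(i | x0 i ord0 == 0) t * `|y i ord0|.
  by apply: eq_bigr => i /eqP i0; rewrite !mxE i0 add0r normrM gtr0_norm.
have : \sum_(i | x0 i ord0 != 0) (`|x0 i ord0| - t * `|y i ord0|) <=
    \sum_(i | x0 i ord0 != 0) `|(x0 + t *: y) i ord0|.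
  apply: ler_sum => i _; rewrite !mxE -{1}(gtr0_norm t0) -normrM.
  exact: lerB_normD.
by rewrite sumrB; lra.
Qed.

(** With blocks taken in decreasing order of magnitude, every block beyond the
    second is controlled by the l1 norm of its predecessor, so these blocks
    together cost at most the l1 norm off the leading block over [sqrt s],
    hence at most the l2 norm of the leading block once that block carries at
    least half of the l1 norm.  The constant [sqrt 5] is the maximum of
    [2 a0 + a1] over the unit circle. *)
Lemma sum_l2norm_blocks_le (R : realType) n s N (r : 'I_n -> 'I_n)
    (y : 'cV[R]_n) :
  (0 < s)%N -> injective r ->
  (forall i j, (r i <= r j)%N -> `|y j ord0| <= `|y i ord0|) ->
  \sum_(i | ((r i %/ s)%N != 0)%N) `|y i ord0| <=
    \sum_(i | ((r i %/ s)%N == 0)%N) `|y i ord0| ->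
  (forall i, r i %/ s < N)%N ->
  \sum_(k < N) l2norm (restr (fun i => (r i %/ s)%N == k) y) <=
    Num.sqrt 5 * l2norm y.
Proof.
move=> s0 rI rdec half bN.
pose l1 k := l1norm (restr (fun i => (r i %/ s)%N == k) y).
pose l2 k := l2norm (restr (fun i => (r i %/ s)%N == k) y).
have l2_ge0 k : 0 <= l2 k by exact: l2norm_ge0.
have ss : (0 : R) < Num.sqrt s%:R by rewrite sqrtr_gt0 ltr0n.
have bN1 i : (r i %/ s < N.+1)%N by rewrite ltnS ltnW.
have bN2 i : (r i %/ s < N.+2)%N by rewrite ltnS ltnW.
have step k : Num.sqrt s%:R * l2 k.+1 <= l1 k.
  apply: l2norm_le_l1norm_dominated => //.
  - exact: card_rank_block_le.
  (* A block followed by a nonempty one is full. *)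
  - move=> i /eqP ik; apply: card_rank_block_ge => //.
    by apply: leq_trans (ltnW (ltn_ord (r i))); rewrite -ik leq_trunc_div.
  - move=> i j /eqP ik /eqP jk; apply: rdec; apply: ltnW.
    rewrite ltnNge; apply/negP => /(leq_div2r s).
    by rewrite ik jk ltnn.
have tail : \sum_(k < N) l2 k.+2 <= l2 0%N.
  rewrite -(ler_pM2l ss) mulr_sumr.
  apply: (@le_trans _ _ (\sum_(k < N) l1 k.+1)); first exact: ler_sum.
  have lead : l1 0%N <= Num.sqrt s%:R * l2 0%N.
    by apply: l1norm_restr_le_l2norm; exact: card_rank_block_le.
  apply: le_trans lead.
  have : l1 0%N + \sum_(k < N) l1 k.+1 = l1norm y.
    by rewrite -(sum_l1norm_restr y bN1) big_ord_recl.
  rewrite [RHS](bigID (fun i => (r i %/ s)%N == 0%N)) /=.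
  have -> : l1 0%N = \sum_(i | ((r i %/ s)%N == 0)%N) `|y i ord0|.
    exact: l1norm_restr.
  by move: half; lra.
have sq : l2 0%N ^+ 2 + l2 1%N ^+ 2 <= l2norm y ^+ 2.
  rewrite -(sum_l2norm_restr_sqr y bN2) !big_ord_recl /= addrA lerDl.
  by apply: sumr_ge0 => k _; exact: sqr_ge0.
(* Two empty blocks are appended so that the first two terms and the tail
   exist whatever [N] is. *)
apply: (@le_trans _ _ (\sum_(k < N.+2) l2 k)).
  by rewrite !big_ord_recr /= -addrA lerDl addr_ge0.
rewrite !big_ord_recl /=.
apply: (@le_trans _ _ (2 * l2 0%N + l2 1%N)).
  by move: tail; rewrite /bump /=; lra.
rewrite -(ler_pXn2r (n := 2)) ?nnegrE.
- rewrite exprMn sqr_sqrtr //.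
  have := sqr_ge0 (l2 0%N - 2 * l2 1%N); nra.
- by [].
- by rewrite addr_ge0 ?mulr_ge0.
- by rewrite mulr_ge0 ?sqrtr_ge0 ?l2norm_ge0.
Qed.

(** * Kernel vectors against descent directions *)

(** With singletons as blocks, [ker_dotv_le] bounds [<x, x>] by a multiple of
    the isometry constant. *)
Lemma ric_eq0_ker (R : realType) m n s (A : 'M[R]_(m, n)) (x : 'cV[R]_n) :
  (0 < s)%N -> ric A (2 * s) = 0 -> A *m x = 0 -> x = 0.
Proof.
move=> s0 A0 Ax0; apply: l2norm_eq0; apply/eqP; rewrite -sqrf_eq0 l2norm_sqr.
rewrite -normr_le0.
have := @ker_dotv_le _ _ _ A s n (fun i : 'I_n => i) x x (@ltn_ord n) _ Ax0.
rewrite A0 mul0r; apply=> k; apply: leq_trans s0; apply/card_le1P => i.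
rewrite inE => /eqP <- j; rewrite !inE; exact: val_eqE.
Qed.

(** Strict because the number [n.-1 %/ s + 1] of blocks is less than
    [n / s + 1], while the isometry constant is positive as soon as the kernel
    contains [x]. *)
Lemma ker_dotv_descent_lt (R : realType) m n s (A : 'M[R]_(m, n))
    (x0 x y : 'cV[R]_n) :
  (0 < s)%N -> (s <= n)%N -> sparse s x0 ->
  descent_cone (@l1norm R n) x0 y -> y != 0 ->
  A *m x = 0 -> x != 0 ->
  dotv x y < Num.sqrt 5 * Num.sqrt (n%:R / s%:R + 1) * ric A (2 * s) *
    (l2norm x * l2norm y).
Proof.
move=> s0 sn sx0 Dy y0 Ax0 xn0.
have [[dl0 _] _] := ric_smallest A (2 * s).
have dlgt0 : 0 < ric A (2 * s).
  rewrite lt_def dl0 andbT; apply: contra_neq xn0 => A0.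
  exact: ric_eq0_ker s0 A0 Ax0.
have [r rI rdec] := exists_rank (fun i => `|y i ord0|).
set N := (n.-1 %/ s).+1.
have n0 : (0 < n)%N by exact: leq_trans sn.
have bN i : (r i %/ s < N)%N.
  by rewrite ltnS leq_div2r // -ltnS prednK.
(* Among sets of [s] indices, the leading block carries the most l1 mass. *)
have half : \sum_(i | ((r i %/ s)%N != 0)%N) `|y i ord0| <=
    \sum_(i | ((r i %/ s)%N == 0)%N) `|y i ord0|.
  have /= top := @sum_le_top _ _ (fun i => x0 i ord0 != 0)
    (fun i => (r i %/ s)%N == 0%N) (fun i => `|y i ord0|).
  have {}top : \sum_(i | x0 i ord0 != 0) `|y i ord0| <=
      \sum_(i | (r i %/ s)%N == 0%N) `|y i ord0|.
    apply: top => //.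
    - apply: leq_trans sx0 _; apply: card_rank_block_ge => //.
      by rewrite mul1n.
    - move=> i j /eqP ri rj; apply: rdec; apply: ltnW; rewrite ltnNge.
      by apply: contra rj => /(leq_div2r s); rewrite ri leqn0.
  have := descent_cone_l1norm Dy.
  have := bigID (fun i => x0 i ord0 == 0) predT (fun i => `|y i ord0|)
    (op := +%R) (idx := 0) (r := index_enum 'I_n).
  have := bigID (fun i => (r i %/ s)%N == 0%N) predT (fun i => `|y i ord0|)
    (op := +%R) (idx := 0) (r := index_enum 'I_n).
  move=> /= -> ; lra.
have sy := @sum_l2norm_blocks_le _ _ _ N r y s0 rI rdec half bN.
have sx := @sum_l2norm_restr_le _ _ N (fun i => (r i %/ s)%N) x bN.
apply: le_lt_trans (ler_norm _) _.
apply: le_lt_trans (@ker_dotv_le _ _ _ A s N _ x y bN _ Ax0) _.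
  by move=> k; exact: card_rank_block_le.
rewrite mulrAC [X in _ < X]mulrC ltr_pM2l //.
apply: le_lt_trans
  (_ : _ <= (Num.sqrt N%:R * l2norm x) * (Num.sqrt 5 * l2norm y)) _.
  by apply: ler_pM => //; apply: sumr_ge0 => k _; exact: l2norm_ge0.
have sN : Num.sqrt N%:R < Num.sqrt (n%:R / s%:R + 1) :> R.
  rewrite ltr_sqrt; last by rewrite ltr_wpDl // divr_ge0.
  rewrite -[N]addn1 natrD ltrD2r ltr_pdivlMr ?ltr0n // -natrM ltr_nat.
  by apply: leq_ltn_trans (leq_trunc_div _ _) _; rewrite prednK.
have c0 : 0 < Num.sqrt 5 * (l2norm x * l2norm y) :> R.
  by rewrite mulr_gt0 ?sqrtr_gt0 ?ltr0n // mulr_gt0 ?l2norm_gt0.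
have := sN; rewrite -(ltr_pM2r c0); lra.
Qed.

Theorem proposition16 (R : realType) (m d s : nat) (A : 'M[R]_(m, d))
    (theta : R)
    (hs1 : (1 <= s)%N) (hsd : (s <= d)%N)
    (htheta0 : 0 <= theta) (htheta_pi : theta <= pi)
    (hdelta : ric A s < 1)
    (hmain :
      1 / (1 - ric A s) *
        (ric A s +
          Num.sqrt 5 * Num.sqrt (d%:R / s%:R + 1) *
            (ric A (2 * s)%N / (1 + ric A s)))
      <= cos theta) :
  forall x0 : 'cV[R]_d, sparse s x0 ->
    expanded_descent_cone theta (@l1norm R d) x0 `&` ker_mx A = [set 0].
Proof.
move=> x0 sx0; apply/seteqP; split=> [x|_ ->]; last first.
  by split; [left|rewrite /ker_mx /= mulmx0].
move=> [[->//|[y [Dy y0 xy]]] Ax0]; apply: contrapT => /eqP xn0; move: xy.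
apply/negP; rewrite -ltNge.
apply: lt_le_trans (ker_dotv_descent_lt hs1 hsd sx0 Dy y0 Ax0 xn0) _.
rewrite -[leRHS]mulrA; apply: ler_wpM2r; first by rewrite mulr_ge0 ?l2norm_ge0.
apply: le_trans hmain.
have [[e0 _] _] := ric_smallest A s.
have [[dl0 _] _] := ric_smallest A (2 * s).
set e := ric A s in hdelta e0 *; set dl := ric A (2 * s) in dl0 *.
set c := Num.sqrt 5 * _.
have K0 : 0 <= c * dl by rewrite !mulr_ge0 ?sqrtr_ge0.
have e1 : 0 < 1 - e by lra.
have e2 : 0 < 1 + e by lra.
rewrite mul1r [leRHS]mulrC ler_pdivlMr // (mulrA c).
apply: (@le_trans _ _ (c * dl / (1 + e))); last by rewrite lerDr.
rewrite ler_pdivlMr //; nra.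
Qed.
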